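(* Let $n\geqslant1$, let $M\in\{\mathrm{PsEnd}(S_n),\mathrm{PswEnd}(S_n),\mathrm{IEnd}(S_n),\mathrm{PEnd}(S_n),\mathrm{PwEnd}(S_n)\}$ and let $\alpha,\beta\in M$. Then $\alpha\,\mathscr{J}\,\beta$ in $M$ if and only if one of the following properties is satisfied: (1) $|\mathrm{Im}(\alpha)|=|\mathrm{Im}(\beta)|\leqslant1$; (2) $|\mathrm{Im}(\alpha)|=|\mathrm{Im}(\beta)|\geqslant2$, [$0\in\mathrm{Dom}(\alpha)$ if and only if $0\in\mathrm{Dom}(\beta)$], and [$0\in\mathrm{Im}(\alpha)$ if and only if $0\in\mathrm{Im}(\beta)$].
   Context: For $n\geqslant1$, the star graph $S_n$ is the simple graph with vertex set $V=\{0,1,\ldots,n-1\}$ and edge set $E=\{\{0,i\}\mid 1\leqslant i\leqslant n-1\}$. $\mathcal{PT}(V)$ is the monoid of all partial transformations of $V$ (including the empty one) under composition; maps are written on the right and composed left to right. A map $\alpha\in\mathcal{PT}(V)$ is, for a graph $G=(V,E)$, with conditions required for all $u,v\in\mathrm{Dom}(\alpha)$: a partial endomorphism if $\{u,v\}\in E\Rightarrow\{u\alpha,v\alpha\}\in E$; a partial weak endomorphism if $\{u,v\}\in E$ and $u\alpha\ne v\alpha$ imply $\{u\alpha,v\alpha\}\in E$; a partial strong endomorphism if $\{u,v\}\in E\Leftrightarrow\{u\alpha,v\alpha\}\in E$; a partial strong weak endomorphism if ($\{u,v\}\in E$ and $u\alpha\ne v\alpha$) $\Leftrightarrow\{u\alpha,v\alpha\}\in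 E$. The sets of all these are the submonoids $\mathrm{PEnd}(G)$, $\mathrm{PwEnd}(G)$, $\mathrm{PsEnd}(G)$, $\mathrm{PswEnd}(G)$ of $\mathcal{PT}(V)$, respectively, and $\mathrm{IEnd}(G)$ is the submonoid of all injective elements of $\mathrm{PEnd}(G)$. Green's relation $\mathscr{J}$ on a monoid $M$: $\alpha\,\mathscr{J}\,\beta$ iff $M\alpha M=M\beta M$. *)

(* Defs.v *)
From HB Require Import structures.
From mathcomp Require Import all_boot.

Set Implicit Arguments.
Unset Strict Implicit.
Unset Printing Implicit Defensive.

(* A partial transformation a of V is encoded by a function V -> option V:
   a x = None means that x is not in the domain of a. *)
Definition ptrans (V : finType) := {ffun V -> option V}.

HB.instance Definition _ (V : finType) := Finite.copy (ptrans V) {ffun V -> option V}.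

Section PartialTransformations.
Variable V : finType.
Implicit Types a b c : ptrans V.

(* Maps act on the right: a * b is "first a, then b". *)
Definition ptrans_mul a b : ptrans V := [ffun x => obind b (a x)].
Definition ptrans_one : ptrans V := [ffun x => Some x].

Lemma ptrans_mulA : associative ptrans_mul.
Proof.
move=> a b c; apply/ffunP => x; rewrite !ffunE.
by case: (a x) => //= y; rewrite ffunE.
Qed.

Lemma ptrans_mul1 : left_id ptrans_one ptrans_mul.
Proof. by move=> a; apply/ffunP => x; rewrite !ffunE. Qed.

Lemma ptrans_mulr1 : right_id ptrans_one ptrans_mul.
Proof.
move=> a; apply/ffunP => x; rewrite !ffunE.
by case: (a x) => //= y; rewrite ffunE.
Qed.

HB.instance Definition _ :=
  isMonoid.Build (ptrans V) ptrans_mulA ptrans_mul1 ptrans_mulr1.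

Lemma ptrans_mulE a b x : (a * b)%g x = obind b (a x).
Proof. exact: ffunE. Qed.

Lemma ptrans_1E x : (1%g : ptrans V) x = Some x.
Proof. exact: ffunE. Qed.

Definition pdom a : {set V} := [set x | a x != None].
Definition pim a : {set V} := [set y | [exists x, a x == Some y]].

(* P u v (u a) (v a) holds for all u, v in the domain of a. *)
Definition on_dom (P : V -> V -> V -> V -> bool) a : bool :=
  [forall u, forall v, forall x, forall y,
     (a u == Some x) && (a v == Some y) ==> P u v x y].

Lemma on_domP (P : V -> V -> V -> V -> bool) a :
  reflect (forall u v x y, a u = Some x -> a v = Some y -> P u v x y)
          (on_dom P a).
Proof.
apply: (iffP idP) => [h u v x y au av | h].
  move/forallP/(_ u)/forallP/(_ v)/forallP/(_ x)/forallP/(_ y): h.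
  by rewrite au av !eqxx.
apply/forallP => u; apply/forallP => v; apply/forallP => x; apply/forallP => y.
by apply/implyP => /andP[/eqP au /eqP av]; apply: h.
Qed.

(* Green's relation J of the submonoid M of PT(V): M a M = M b M. *)
Definition greenJ (M : {set ptrans V}) a b : Prop :=
  [set (g * a * d)%g | g : ptrans V in M, d : ptrans V in M] =
  [set (g * b * d)%g | g : ptrans V in M, d : ptrans V in M].

End PartialTransformations.

Record sgraph (V : finType) := SGraph {
  edges :> {set {set V}};
  card_edge : {in edges, forall e : {set V}, #|e| = 2}
}.

Section Endomorphisms.
Variables (V : finType) (G : sgraph V).

Definition edge (u v : V) : bool := [set u; v] \in edges G.

Lemma edge_irrefl u : edge u u = false.
Proof. by apply/negP => /card_edge; rewrite setUid cards1. Qed.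

Lemma edge_sym u v : edge u v = edge v u.
Proof. by rewrite /edge setUC. Qed.

Definition PEnd : {set ptrans V} :=
  [set a | on_dom (fun u v x y => edge u v ==> edge x y) a].

Definition PwEnd : {set ptrans V} :=
  [set a | on_dom (fun u v x y => edge u v && (x != y) ==> edge x y) a].

Definition PsEnd : {set ptrans V} :=
  [set a | on_dom (fun u v x y => edge u v == edge x y) a].

Definition PswEnd : {set ptrans V} :=
  [set a | on_dom (fun u v x y => (edge u v && (x != y)) == edge x y) a].

Definition IEnd : {set ptrans V} :=
  [set a in PEnd | on_dom (fun u v x y => (x == y) ==> (u == v)) a].

Lemma on_dom_monoid (P : V -> V -> V -> V -> bool) :
    (forall u v, P u v u v) ->
    (forall u v x y z t, (x = y -> z = t) ->
       P u v x y -> P x y z t -> P u v z t) ->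
  monoid_closed [set a | on_dom P a].
Proof.
move=> P1 PM; split=> [|a b].
  by rewrite inE; apply/on_domP => u v x y; rewrite !ffunE => -[<-] [<-].
rewrite !inE => /on_domP ha /on_domP hb; apply/on_domP => u v z t.
rewrite !ffunE; case au: (a u) => [x|] //= bx; case av: (a v) => [y|] //= yt.
apply: PM (ha _ _ _ _ au av) (hb _ _ _ _ bx yt) => xy.
by move: bx; rewrite xy yt => -[].
Qed.

Lemma PEnd_monoid : monoid_closed PEnd.
Proof.
apply: on_dom_monoid => [u v|u v x y z t _]; first exact: implybb.
by move=> /implyP h1 /implyP h2; apply/implyP => /h1/h2.
Qed.

Lemma PsEnd_monoid : monoid_closed PsEnd.
Proof.
by apply: on_dom_monoid => [u v|u v x y z t _ /eqP-> /eqP->]; rewrite eqxx.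
Qed.

Lemma PwEnd_monoid : monoid_closed PwEnd.
Proof.
apply: on_dom_monoid => [u v|u v x y z t xyzt].
  by apply/implyP => /andP[].
move=> /implyP h1 /implyP h2; apply/implyP => /andP[uv zt].
have xy : x != y by apply: contraNneq zt => /xyzt->.
by apply: h2; rewrite zt h1 // uv.
Qed.

Lemma PswEnd_monoid : monoid_closed PswEnd.
Proof.
apply: on_dom_monoid => [u v|u v x y z t xyzt].
  by case: (eqVneq u v) => [->|_]; rewrite ?edge_irrefl ?andbT.
move=> /eqP h1 /eqP <-; rewrite -h1 -andbA.
by case: (eqVneq x y) => [/xyzt->|_]; rewrite ?eqxx.
Qed.

Lemma IEnd_monoid : monoid_closed IEnd.
Proof.
have [P1 PM] := PEnd_monoid.
have [I1 IM] : monoid_closed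
    [set a | on_dom (fun u v x y : V => (x == y) ==> (u == v)) a].
  apply: on_dom_monoid => [u v|u v x y z t _ /implyP h1 /implyP h2].
    exact: implybb.
  by apply/implyP => /h2/h1.
have IE : IEnd = PEnd :&: [set a | on_dom (fun u v x y : V =>
    (x == y) ==> (u == v)) a] by apply/setP => a; rewrite !inE.
rewrite IE; split=> [|a b]; first by rewrite inE P1 I1.
by rewrite !(in_setI _ PEnd) => /andP[aP aI] /andP[bP bI]; rewrite PM ?IM.
Qed.

End Endomorphisms.

Section Star.
Variables (n : nat) (n_gt0 : 0 < n).

Definition center : 'I_n := Ordinal n_gt0.

Definition star_edges : {set {set 'I_n}} :=
  [set [set center; i] | i : 'I_n & 1 <= i].

Lemma card_star_edge : {in star_edges, forall e : {set 'I_n}, #|e| = 2}.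
Proof.
move=> e /imsetP[i]; rewrite inE => i_gt0 ->.
by rewrite cards2 -val_eqE /= eq_sym -lt0n i_gt0.
Qed.

Definition star : sgraph 'I_n := SGraph card_star_edge.

End Star.

(* Main.v *)
Require Import Defs.
From mathcomp Require Import all_boot.

Set Implicit Arguments.
Unset Strict Implicit.
Unset Printing Implicit Defensive.

(** Forward direction: a partial weak endomorphism of the star which is defined
    at the center and separates it from another point has the center among
    those two values.  If [a = g b d], applying this to [g] transfers the
    center from the domain of [a] to that of [b]; if moreover [b = g' a d']
    has the same rank as [a], then [d'] is total and injective on the image of
    [a], and the same remark on [d'] transfers the center from the image of [a]
    to that of [b].

    Converse: take a bijection [f] from [Im a] onto [Im b] respecting edges and
    a section [r] of [b].  Then [a = (a f r) b f^-1], and [r] can be chosen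
    such that [a f r] lies in [M]: if the center is in the domain of [b], we let
    it represent its class, and then [r] preserves and reflects edges; otherwise
    neither the domain nor the image of [a f r] contains an edge. *)

(** * Ranks of products, Green's relation J as mutual factorization, and bijections with a
    prescribed point *)

Section PartialTransformations.
Variable V : finType.
Implicit Types a b d g : ptrans V.

Lemma pdomP a x : reflect (exists y, a x = Some y) (x \in pdom a).
Proof.
rewrite inE; case: (a x) => [y|] /=; constructor; first by exists y.
by case.
Qed.

Lemma pimP a y : reflect (exists x, a x = Some y) (y \in pim a).
Proof.
rewrite inE; apply: (iffP existsP) => [[x /eqP]|[x /eqP]]; by exists x.
Qed.

Lemma pim_mulr g b : pim (g * b)%g \subset pim b.
Proof.
apply/subsetP => y /pimP[x]; rewrite ptrans_mulE.
by case: (g x) => //= z bz; apply/pimP; exists z.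
Qed.

(** The inclusion lives in [option V] because [d] may be undefined on [pim b]. It bounds the rank,
    and when the ranks agree it forces [d] to be total on that image. *)
Lemma pim_mul_imset b d : Some @: pim (b * d)%g \subset d @: pim b.
Proof.
apply/subsetP => t /imsetP[y /pimP[x] bdx ->]; move: bdx; rewrite ptrans_mulE.
case bx: (b x) => [z|] //= dz; rewrite -dz; apply: imset_f.
by apply/pimP; exists x.
Qed.

Lemma card_pim_mull b d : #|pim (b * d)%g| <= #|pim b|.
Proof.
rewrite -(card_imset _ (@Some_inj _)).
exact: leq_trans (subset_leq_card (pim_mul_imset b d)) (leq_imset_card _ _).
Qed.

Lemma card_pim_mul g b d : #|pim (g * b * d)%g| <= #|pim b|.
Proof.
exact: leq_trans (card_pim_mull _ _) (subset_leq_card (pim_mulr g b)).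
Qed.

(** The identity puts each element in its own two-sided ideal, and closure under products turns a
    factorization into an inclusion of ideals. *)
Lemma greenJP (M : {set ptrans V}) a b : monoid_closed M ->
  greenJ M a b <->
  (exists g d, [/\ g \in M, d \in M & a = (g * b * d)%g]) /\
  (exists g d, [/\ g \in M, d \in M & b = (g * a * d)%g]).
Proof.
move=> [M1 MM].
have sub a' b' : (exists g d, [/\ g \in M, d \in M & a' = (g * b' * d)%g]) ->
    [set (g * a' * d)%g | g : ptrans V in M, d : ptrans V in M] \subset
    [set (g * b' * d)%g | g : ptrans V in M, d : ptrans V in M].
  case=> g [d [gM dM ->]]; apply/subsetP => t /imset2P[h k hM kM ->].
  apply/imset2P; exists (h * g)%g (d * k)%g; rewrite ?MM //.
  by rewrite !monoid.mulgA.
have self a' :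
    a' \in [set (g * a' * d)%g | g : ptrans V in M, d : ptrans V in M].
  by apply/imset2P; exists 1%g 1%g; rewrite // monoid.mul1g monoid.mulg1.
split=> [J|[ab ba]].
  split; [have := self a; rewrite J | have := self b; rewrite -J];
    by case/imset2P => g d gM dM e; exists g, d.
by apply/eqP; rewrite eqEsubset !sub.
Qed.

Lemma cards_gt1_neq (A : {set V}) x : 1 < #|A| -> exists2 y, y \in A & y != x.
Proof.
case/card_gt1P => y [z [yA zA yz]].
case: (eqVneq y x) => [yx|]; last by exists y.
by exists z; rewrite // -yx eq_sym.
Qed.

(** Remove [c] from both sets and match the enumerations of what remains, index by index. The last
    clause will make [f] respect the edges of the star. *)
Lemma bij_fixing_point (c : V) (A B : {set V}) : #|A| = #|B| ->
  (c \in A) = (c \in B) ->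
  exists f : V -> V, [/\ {in A, forall x, f x \in B}, {in A &, injective f}
                       & {in A, forall x, (f x == c) = (x == c)}].
Proof.
move=> AB cAB; pose A' := A :\ c; pose B' := B :\ c.
have cardE : size (enum A') = size (enum B').
  by move: AB; rewrite -!cardE (cardsD1 c A) (cardsD1 c B) cAB => /addnI.
pose f' x := nth c (enum B') (index x (enum A')).
have f'B x : x \in A' -> f' x \in B'.
  move=> xA; rewrite -mem_enum; apply: mem_nth.
  by rewrite -cardE index_mem mem_enum.
have A'P x : x \in A -> x != c -> x \in A' by rewrite !inE => -> ->.
have f'c x : x \in A -> x != c -> f' x != c.
  by move=> xA xc; have := f'B _ (A'P _ xA xc); rewrite in_setD1 => /andP[].
exists (fun x => if x == c then c else f' x); split=> [x xA|x y xA yA|x xA].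
- case: (eqVneq x c) => [xc|xc]; first by rewrite -cAB -xc.
  by have := f'B _ (A'P _ xA xc); rewrite in_setD1 => /andP[].
- case: (eqVneq x c) => [->|xc]; case: (eqVneq y c) => [->|yc] //.
  + by move=> e; have := f'c _ yA yc; rewrite -e eqxx.
  + by move=> e; have := f'c _ xA xc; rewrite e eqxx.
  + have xi : index x (enum A') < size (enum A').
      by rewrite index_mem mem_enum A'P.
    have yi : index y (enum A') < size (enum A').
      by rewrite index_mem mem_enum A'P.
    move/eqP; rewrite nth_uniq -?cardE ?enum_uniq // => /eqP e.
    by rewrite -(nth_index c (_ : x \in enum A')) ?mem_enum ?A'P // e
               nth_index // mem_enum A'P.
- by case: (eqVneq x c) => [|xc]; [rewrite eqxx | apply/negbTE/f'c].
Qed.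

End PartialTransformations.

(** * The center of the star in domains and images of products *)

Section Star.
Variables (n : nat) (n_gt0 : 0 < n).
Local Notation c := (center n_gt0).
Local Notation S := (star n_gt0).
Local Notation E := (edge S).
Implicit Types a b d g : ptrans 'I_n.

Lemma star_edgeE u v : E u v = ((u == c) != (v == c)).
Proof.
have pos (i : 'I_n) : (1 <= i) = (i != c) by rewrite -val_eqE /= lt0n.
case: (eqVneq u v) => [->|uv]; first by rewrite edge_irrefl eqxx.
apply/imsetP/idP => [[i]|].
  rewrite inE pos => ic e.
  have : u \in [set c; i] by rewrite -e !inE eqxx.
  have : v \in [set c; i] by rewrite -e !inE eqxx orbT.
  rewrite !inE => /orP[]/eqP ev /orP[]/eqP eu; move: uv ic;
    by rewrite eu ev ?eqxx // => _ /negbTE ->.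
case: (eqVneq u c) => [->|uc]; case: (eqVneq v c) => [->|vc] // _.
  by exists v; rewrite // inE pos.
by exists u; rewrite 1?setUC // inE pos.
Qed.

(** If [g] separates [c] from [v], then [v] is not [c], so the two are joined; hence their values
    are joined, and every edge contains [c]. *)
Lemma PwEnd_center g v y z : g \in PwEnd S ->
  g c = Some y -> g v = Some z -> y != z -> (y == c) || (z == c).
Proof.
rewrite inE => /on_domP gP gc gv yz; have /implyP := gP _ _ _ _ gc gv.
rewrite !star_edgeE eqxx yz andbT; case: (eqVneq v c) => [vc|_ /(_ isT)].
  by move: gv yz; rewrite vc gc => -[->]; rewrite eqxx.
by case: (y == c); case: (z == c).
Qed.

Lemma center_pdom_mul g b d : g \in PwEnd S ->
  1 < #|pim (g * b * d)%g| -> c \in pdom (g * b * d)%g -> c \in pdom b.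
Proof.
move=> gP rk /pdomP[p ac].
have [q /pimP[v av] qp] := cards_gt1_neq p rk.
move: ac av; rewrite !ptrans_mulE.
case gc: (g c) => [y|] //=; case gv: (g v) => [z|] //= byp bzq.
have yz : y != z.
  by apply: contraNneq qp => yz; move: byp; rewrite yz bzq => -[->].
case/orP: (PwEnd_center gP gc gv yz) => /eqP <-; apply/pdomP.
  by case: (b y) byp => // t _; exists t.
by case: (b z) bzq => // t _; exists t.
Qed.

Lemma center_pim_mul g a d : d \in PwEnd S ->
  #|pim (g * a * d)%g| = #|pim a| -> 1 < #|pim a| ->
  c \in pim a -> c \in pim (g * a * d)%g.
Proof.
set b := (g * a * d)%g => dP rk rk2 ca.
have sub : Some @: pim b \subset d @: pim a.
  exact: subset_trans (pim_mul_imset _ _) (imsetS _ (pim_mulr g a)).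
(* Equal ranks turn the inclusion into an equality, so [None] is not a value of [d] on [pim a]; in
   particular [d c] is defined. *)
have /eqP eb : Some @: pim b == d @: pim a.
  rewrite eqEcard sub (card_imset (pim b) (@Some_inj _)) rk.
  exact: leq_imset_card.
have : d c \in Some @: pim b by rewrite eb imset_f.
case/imsetP => p pb dc.
have [|q qb qp] := @cards_gt1_neq _ (pim b) p; first by rewrite rk.
have : Some q \in d @: pim a by rewrite -eb imset_f.
case/imsetP => v _ dv; rewrite eq_sym in qp.
by case/orP: (PwEnd_center dP dc (esym dv) qp) => /eqP <-.
Qed.

(** * Properties common to the five monoids *)

Section Monoid.
Variable M : {set ptrans 'I_n}.
Hypothesis M_in : M \in [:: PsEnd S; PswEnd S; IEnd S; PEnd S; PwEnd S].

Lemma endo_monoid : monoid_closed M.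
Proof.
move: M_in; rewrite !inE => /or4P[|||/orP[]] /eqP ->.
- exact: PsEnd_monoid.
- exact: PswEnd_monoid.
- exact: IEnd_monoid.
- exact: PEnd_monoid.
- exact: PwEnd_monoid.
Qed.

Lemma endo_sub_PwEnd : M \subset PwEnd S.
Proof.
apply/subsetP => a aM; rewrite inE; apply/on_domP => u v x y au av.
move: M_in aM; rewrite !inE => /or4P[|||/orP[]] /eqP ->; rewrite !inE.
- by move/on_domP/(_ _ _ _ _ au av)/eqP=> <-; apply/implyP => /andP[].
- by move/on_domP/(_ _ _ _ _ au av)/eqP=> <-; apply: implybb.
- case/andP => /on_domP/(_ _ _ _ _ au av)/implyP h _.
  by apply/implyP => /andP[/h].
- move/on_domP/(_ _ _ _ _ au av)/implyP => h.
  by apply/implyP => /andP[/h].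
- by move/on_domP/(_ _ _ _ _ au av).
Qed.

(* The kernel condition matters for [IEnd] only; with [a := 1] it says that [g]
   is injective, so every partial isomorphism of the star is in [M]. *)
Lemma endo_of_kernel a g : a \in M ->
  (forall u v x y, g u = Some x -> g v = Some y ->
     E u v = E x y /\ (x = y -> exists2 z, a u = Some z & a v = Some z)) ->
  g \in M.
Proof.
move=> aM gP; move: M_in aM.
rewrite !inE => /or4P[|||/orP[]] /eqP ->; rewrite !inE.
- by move=> _; apply/on_domP => u v x y gu gv; have [-> _] := gP _ _ _ _ gu gv.
- move=> _; apply/on_domP => u v x y gu gv; have [-> _] := gP _ _ _ _ gu gv.
  by case: (eqVneq x y) => [->|_]; rewrite ?edge_irrefl ?andbT.
- case/andP => _ /on_domP inj; apply/andP.
  split; apply/on_domP => u v x y gu gv;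
    have [e k] := gP _ _ _ _ gu gv; first by rewrite e implybb.
  apply/implyP => /eqP/k[z au av].
  by have := inj _ _ _ _ au av; rewrite eqxx.
- move=> _; apply/on_domP => u v x y gu gv; have [-> _] := gP _ _ _ _ gu gv.
  exact: implybb.
- move=> _; apply/on_domP => u v x y gu gv; have [-> _] := gP _ _ _ _ gu gv.
  by apply/implyP => /andP[].
Qed.

(** * Factorizations through an element of the same rank *)

Lemma endo_factor a b (f r : 'I_n -> 'I_n) :
  {in pim a &, injective f} ->
  {in pim a &, forall x y, E (f x) (f y) = E x y} ->
  {in pim a, forall x, b (r (f x)) = Some (f x)} ->
  ([ffun u => omap (r \o f) (a u)] : ptrans 'I_n) \in M ->
  exists g d, [/\ g \in M, d \in M & a = (g * b * d)%g].
Proof.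
move=> f_inj fE br gM.
(* The inverse of [f], defined on the image of [pim a] only: a partial isomorphism, hence in [M]. *)
pose d : ptrans 'I_n := [ffun y => [pick x in pim a | f x == y]].
have dP y x : d y = Some x -> x \in pim a /\ f x = y.
  by rewrite ffunE; case: pickP => // z /andP[za /eqP <-] [<-].
have dK x : x \in pim a -> d (f x) = Some x.
  move=> xa; rewrite ffunE; case: pickP => [z /andP[za /eqP]|/(_ x)].
    by move/f_inj => ->.
  by rewrite xa eqxx.
exists [ffun u => omap (r \o f) (a u)], d; split=> //.
- have [M1 _] := endo_monoid.
  apply: (endo_of_kernel M1) => u v x y /dP[xa <-] /dP[ya <-].
  by split=> [|->]; [exact: fE | exists (f y); rewrite ptrans_1E].
- apply/ffunP => u; rewrite !ptrans_mulE ffunE.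
  case au: (a u) => [x|] //=.
  have xa : x \in pim a by apply/pimP; exists u.
  by rewrite br //= dK.
Qed.

(** Here [r \o f] restricted to [pim a] is itself a partial isomorphism [t], injective because [b]
    recovers [f x] from [r (f x)]; so the left factor is the product [a * t] of elements of [M]. *)
Lemma endo_factor_iso a b (f r : 'I_n -> 'I_n) : a \in M ->
  {in pim a &, injective f} ->
  {in pim a &, forall x y, E (f x) (f y) = E x y} ->
  {in pim a, forall x, b (r (f x)) = Some (f x)} ->
  {in pim a &, forall x y, E (r (f x)) (r (f y)) = E x y} ->
  exists g d, [/\ g \in M, d \in M & a = (g * b * d)%g].
Proof.
move=> aM f_inj fE br rfE; apply: (endo_factor f_inj fE br).
have [M1 MM] := endo_monoid.
pose t : ptrans 'I_n :=
  [ffun x => if x \in pim a then Some (r (f x)) else None].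
have tP x y : t x = Some y -> x \in pim a /\ r (f x) = y.
  by rewrite ffunE; case: ifP => // xa [].
suff -> : [ffun u => omap (r \o f) (a u)] = (a * t)%g.
  apply: MM aM _; apply: (endo_of_kernel M1) => u v x y /tP[ua <-] /tP[va <-].
  split=> [|e]; first by rewrite rfE.
  have uv : u = v.
    by apply: f_inj => //; have := br _ ua; rewrite e br // => -[].
  by exists u; rewrite ptrans_1E ?uv.
apply/ffunP => u; rewrite ptrans_mulE ffunE; case au: (a u) => [x|] //=.
by rewrite ffunE; case: ifPn => // /pimP[]; exists u.
Qed.

(** The point [v] is made the representative of its own class; it will be the center. *)
Lemma section_through b v : exists r : 'I_n -> 'I_n,
  {in pim b, forall y, b (r y) = Some y} /\ (forall y, b v = Some y -> r y = v).
Proof.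
exists (fun y => if b v == Some y then v else odflt v [pick u | b u == Some y]).
split=> [y /pimP[u bu]|y ->]; last by rewrite eqxx.
case: ifP => [/eqP //|_]; case: pickP => [w /eqP //|/(_ u)].
by rewrite bu eqxx.
Qed.

(** A set with at most one point contains no edge, so all edge conditions are trivial. *)
Lemma endo_factor_card_le1 a b : a \in M -> #|pim a| = #|pim b| ->
  #|pim b| <= 1 -> exists g d, [/\ g \in M, d \in M & a = (g * b * d)%g].
Proof.
move=> aM ab b1; have a1 : #|pim a| <= 1 by rewrite ab.
have eq_a : {in pim a &, forall x y, x = y}.
  by move=> x y xa ya; apply: (card_le1_eqP a1).
have [r [br _]] := section_through b c.
(* The default [c] occurs only if [pim b] is empty, and then so is [pim a]. *)
pose f (x : 'I_n) := odflt c [pick y in pim b].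
have fb : {in pim a, forall x, f x \in pim b}.
  move=> x xa; rewrite /f; case: pickP => //= b0.
  have : 0 < #|pim a| by apply/card_gt0P; exists x.
  by rewrite ab eq_card0.
apply: (endo_factor_iso (f := f) (r := r)) => //.
- by move=> x y xa ya _; apply: eq_a.
- by move=> x y xa ya; rewrite (eq_a _ _ xa ya) !edge_irrefl.
- by move=> x /fb/br.
- by move=> x y xa ya; rewrite (eq_a _ _ xa ya) !edge_irrefl.
Qed.

(* If [b] moves the center to some [p != c], its image is [c, p], so that
   [y == p] is the negation of [y == c] there. *)
Lemma PwEnd_edge_pim b p : b \in PwEnd S -> b c = Some p ->
  {in pim b &, forall y z, ((y == p) != (z == p)) = E y z}.
Proof.
move=> bP bc y z yb zb; rewrite star_edgeE.
case: (eqVneq p c) => [-> //|pc].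
have pimE t : t \in pim b -> (t == p) = (t != c).
  case/pimP => v bv; case: (eqVneq t p) => [->|tp]; first by rewrite pc.
  rewrite eq_sym in tp; have := PwEnd_center bP bc bv tp.
  by rewrite (negbTE pc) /= => ->.
by rewrite !pimE //; case: (y == c); case: (z == c).
Qed.

Lemma endo_factor_center a b : a \in M -> b \in M -> #|pim a| = #|pim b| ->
  (c \in pdom a) = (c \in pdom b) -> (c \in pim a) = (c \in pim b) ->
  exists g d, [/\ g \in M, d \in M & a = (g * b * d)%g].
Proof.
move=> aM bM ab dom_ab im_ab.
have [f [fb f_inj fc]] := bij_fixing_point ab im_ab.
have fE : {in pim a &, forall x y, E (f x) (f y) = E x y}.
  by move=> x y xa ya; rewrite !star_edgeE !fc.
have [r [br rc]] := section_through b c.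
have brf : {in pim a, forall x, b (r (f x)) = Some (f x)} by move=> x /fb/br.
case: (boolP (c \in pdom b)) dom_ab => [/pdomP[p bc] _|cb ca].
  (* On [pim b], [r] takes the value [c] exactly at [p], and the edges there are the pairs with
     exactly one point equal to [p]. *)
  apply: (endo_factor_iso (f := f) (r := r)) => // x y xa ya.
  have rP t : t \in pim b -> (r t == c) = (t == p).
    move=> tb; apply/eqP/eqP => [rt|->]; last exact: rc.
    by have := br _ tb; rewrite rt bc => -[].
  rewrite star_edgeE !rP ?fb // -fE //.
  apply: (PwEnd_edge_pim _ bc); rewrite ?fb //; exact: (subsetP endo_sub_PwEnd).
apply: (endo_factor f_inj fE brf).
have nc d u x : c \notin pdom d -> d u = Some x -> (u == c) = false.
  move=> cd du; apply: contraNF cd => /eqP <-; apply/pdomP; by exists x.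
(* Values of [r \o f] on [pim a] lie in [pdom b], which avoids [c], as does [pdom a]: no edge on
   either side. The kernel is that of [a] because [b] undoes [r]. *)
apply: (endo_of_kernel aM) => u v x y; rewrite !ffunE.
case au: (a u) => [s|] //= [<-]; case av: (a v) => [t|] //= [<-].
have sa : s \in pim a by apply/pimP; exists u.
have ta : t \in pim a by apply/pimP; exists v.
have ca' : c \notin pdom a by rewrite ca.
split=> [|e].
  by rewrite !star_edgeE (nc _ _ _ ca' au) (nc _ _ _ ca' av)
             (nc _ _ _ cb (brf _ sa)) (nc _ _ _ cb (brf _ ta)).
exists s => //; congr Some; apply: f_inj => //.
by have := brf _ sa; rewrite e brf // => -[].
Qed.

End Monoid.
End Star.

Theorem proposition2p9 (n : nat) (n_gt0 : 1 <= n) (M : {set ptrans 'I_n})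
    (M_in : M \in [:: PsEnd (star n_gt0); PswEnd (star n_gt0);
                      IEnd (star n_gt0); PEnd (star n_gt0);
                      PwEnd (star n_gt0)])
    (a b : ptrans 'I_n) (aM : a \in M) (bM : b \in M) :
  greenJ M a b <->
    (#|pim a| = #|pim b| /\ #|pim b| <= 1) \/
    [/\ #|pim a| = #|pim b|, 2 <= #|pim b|,
        (center n_gt0 \in pdom a <-> center n_gt0 \in pdom b)
      & (center n_gt0 \in pim a <-> center n_gt0 \in pim b)].
Proof.
have [J_factor factor_J] := greenJP a b (endo_monoid M_in).
split=> [/J_factor[[g [d [gM dM ea]]] [g' [d' [gM' dM' eb]]]]|rk_J].
  have Pw := subsetP (endo_sub_PwEnd M_in).
  have ab : #|pim a| = #|pim b|.
    by apply/anti_leq/andP; split; [rewrite ea | rewrite eb];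
      apply: card_pim_mul.
  case: (leqP #|pim b| 1) => rk; [by left | right].
  have rka : 1 < #|pim a| by rewrite ab.
  split=> //; split.
  (* The center passes from the domain of a product to that of its middle factor, but from the image
     of the middle factor to that of the product; so domains and images use opposite
     factorizations. *)
  - by move: rka; rewrite ea; apply/center_pdom_mul/Pw.
  - by move: rk; rewrite eb; apply/center_pdom_mul/Pw.
  - by rewrite eb; apply: center_pim_mul; rewrite -?eb // Pw.
  - by rewrite ea; apply: center_pim_mul; rewrite -?ea // Pw.
apply: factor_J; case: rk_J => [[ab rk]|[ab rk dom_ab im_ab]].
  by split; apply: (endo_factor_card_le1 M_in); rewrite ?ab.
have {}dom_ab : (center n_gt0 \in pdom a) = (center n_gt0 \in pdom b).
  by apply/idP/idP => /dom_ab.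
have {}im_ab : (center n_gt0 \in pim a) = (center n_gt0 \in pim b).
  by apply/idP/idP => /im_ab.
by split; apply: (endo_factor_center M_in).
Qed.
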